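(* Suppose $\theta$ and $\lambda$ are regular cardinals and either $\theta^+<\lambda<\theta^{+\theta}$ or $\lambda$ is $\theta$-inaccessible. Let $\mathcal{D}$ be a locally downward coherent $\theta$-covering matrix for $\lambda$. Then $S^\lambda_{>\theta}\setminus A_{\mathcal{D}}$ is non-stationary in $\lambda$.
   Context: $\lambda$ is $\theta$-inaccessible if $\kappa^\theta<\lambda$ for all $\kappa<\lambda$; $S^\lambda_{>\theta}=\{\alpha<\lambda\mid\mathrm{cf}(\alpha)>\theta\}$. A $\theta$-covering matrix for $\lambda$ is $\mathcal{D}=\langle D(i,\beta)\mid i<\theta,\beta<\lambda\rangle$ with $\beta=\bigcup_{i<\theta}D(i,\beta)$, $D(i,\beta)\subseteq D(j,\beta)$ for $i<j$, and for $\beta<\gamma<\lambda$, $i<\theta$ some $j<\theta$ with $D(i,\beta)\subseteq D(j,\gamma)$. Locally downward coherent: for every $X\subseteq\lambda$ with $|X|\le\theta$ there is $\gamma_X<\lambda$ such that for all $\beta<\lambda$, $i<\theta$ there is $j<\theta$ with $X\cap D(i,\beta)\subseteq X\cap D(j,\gamma_X)$. $\beta\in S^\lambda_{>\theta}$ is a good point for $\mathcal{D}$ if there is an unbounded $A\subseteq\beta$ such that for every $\gamma<\beta$ there are $\alpha<\beta$, $i<\theta$ with $A\cap\gamma\subseteq D(i,\alpha)$; $A_{\mathcal{D}}$ is the set of good points. *)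

(* Defs.v *)
From HB Require Import structures.
From mathcomp Require Import all_boot all_order.
From mathcomp Require Import all_classical.

Set Implicit Arguments.
Unset Strict Implicit.
Unset Printing Implicit Defensive.

Local Open Scope classical_set_scope.
Local Open Scope card_scope.

Record wellorder := WellOrder {
  wo_car :> Type;
  wo_lt : wo_car -> wo_car -> Prop;
  wo_trans : forall x y z, wo_lt x y -> wo_lt y z -> wo_lt x z;
  wo_total : forall x y, [\/ wo_lt x y, x = y | wo_lt y x];
  wo_wf : well_founded wo_lt }.

HB.instance Definition _ := gen_eqMixin wellorder.
HB.instance Definition _ := gen_choiceMixin wellorder.

Definition wo_iso (v w : wellorder) : Prop :=
  exists2 f : v -> w, bijective f & forall x y, wo_lt x y <-> wo_lt (f x) (f y).

Fact sval_inj T (P : T -> Prop) (a b : {x | P x}) : sval a = sval b -> a = b.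
Proof. by case: a b => [x Px] [y Py] /= xy; case: y / xy Py => Py; rewrite (Prop_irrelevance Px Py). Qed.

Section InitialSegment.
Variables (w : wellorder) (x : w).
Let car := {y : w | wo_lt y x}.
Let lt (a b : car) := wo_lt (sval a) (sval b).

Fact wo_seg_trans a b c : lt a b -> lt b c -> lt a c.
Proof. exact: wo_trans. Qed.

Fact wo_seg_total a b : [\/ lt a b, a = b | lt b a].
Proof.
case: (wo_total (sval a) (sval b)) => [h|h|h]; [by constructor 1| |by constructor 3].
by constructor 2; apply: sval_inj.
Qed.

Fact wo_seg_wf : well_founded lt.
Proof.
move=> a; move: {-1}(sval a) (erefl (sval a)) => y.
elim/(well_founded_ind (@wo_wf w)): y a => y IH a ay.
by split=> b ba; apply: (IH (sval b)) => //; rewrite -ay.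
Qed.

Definition wo_seg : wellorder := WellOrder wo_seg_trans wo_seg_total wo_seg_wf.
End InitialSegment.

Definition wo_isob (v w : wellorder) : bool := `[< wo_iso v w >].

Fact wo_iso_refl w : wo_iso w w.
Proof. by exists id => //; exists id. Qed.

Fact wo_iso_sym v w : wo_iso v w -> wo_iso w v.
Proof.
move=> [f [g fg gf] fP]; exists g; first by exists f.
by move=> x y; rewrite -{1}(gf x) -{1}(gf y); split => /fP.
Qed.

Fact wo_iso_trans u v w : wo_iso u v -> wo_iso v w -> wo_iso u w.
Proof.
move=> [f bf fP] [g bg gP]; exists (g \o f); first exact: bij_comp.
by move=> x y; split => [/fP/gP|/gP/fP].
Qed.

Fact wo_isob_refl : reflexive wo_isob.
Proof. by move=> w; apply/asboolP/wo_iso_refl. Qed.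

Fact wo_isob_sym : symmetric wo_isob.
Proof. by move=> v w; apply/asboolP/asboolP; apply: wo_iso_sym. Qed.

Fact wo_isob_trans : transitive wo_isob.
Proof.
by move=> v u w /asboolP uv /asboolP vw; apply/asboolP/(wo_iso_trans uv vw).
Qed.

Canonical wo_isob_equiv := EquivRel wo_isob wo_isob_refl wo_isob_sym wo_isob_trans.

(* The ordinals, as isomorphism classes of well-orders on the types of a fixed
   universe. *)
Definition On := {eq_quot wo_isob}%qT.
HB.instance Definition _ := Choice.on On.
HB.instance Definition _ := EqQuotient.on On.

Definition otype (w : wellorder) : On := (\pi_On w)%qT.

Definition On_lt (a b : On) : bool :=
  `[< exists x : repr b, a = otype (wo_seg x) >].

Lemma otype_eq v w : (otype v = otype w) <-> wo_iso v w.
Proof.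
split=> [/eqmodP/asboolP//|vw]; exact/eqmodP/asboolP.
Qed.

Lemma otype_repr a : otype (repr a) = a.
Proof. exact: reprK. Qed.

Fact wo_seg_iso (v w : wellorder) (f : v -> w) (x : v) : bijective f ->
  (forall y z, wo_lt y z <-> wo_lt (f y) (f z)) -> wo_iso (wo_seg x) (wo_seg (f x)).
Proof.
move=> [g fg gf] fP.
have gP y : wo_lt y (f x) -> wo_lt (g y) x by move=> h; apply/fP; rewrite gf.
exists (fun y : wo_seg x => exist _ (f (sval y)) ((fP _ _).1 (svalP y)) : wo_seg (f x)).
  exists (fun y : wo_seg (f x) => exist _ (g (sval y)) (gP _ (svalP y)) : wo_seg x).
    by case=> y yx; apply: sval_inj => /=.
  by case=> y yx; apply: sval_inj => /=.
by move=> y z; apply: fP.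
Qed.

Lemma On_ltP a w : On_lt a (otype w) <-> exists x : w, a = otype (wo_seg x).
Proof.
have /otype_eq rw : otype (repr (otype w)) = otype w by rewrite otype_repr.
split=> [/asboolP[x ->]|[x ->]].
  have [f bf fP] := rw; exists (f x); apply/otype_eq; exact: wo_seg_iso.
have [f bf fP] := wo_iso_sym rw; apply/asboolP; exists (f x).
by apply/otype_eq; exact: wo_seg_iso.
Qed.

Fact wo_seg_seg (w : wellorder) (x : w) (y : wo_seg x) :
  otype (wo_seg y) = otype (wo_seg (sval y)).
Proof.
apply/otype_eq; case: y => y yx /=.
exists (fun z : wo_seg (exist _ y yx : wo_seg x) =>
  exist _ (sval (sval z)) (svalP z) : wo_seg y); last by [].
exists (fun z : wo_seg y =>
  exist _ (exist _ (sval z) (wo_trans (svalP z) yx) : wo_seg x) (svalP z) :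
  wo_seg (exist _ y yx : wo_seg x)).
  by case=> [[z zx] zy]; do 2!apply: sval_inj => /=.
by case=> z zy; apply: sval_inj.
Qed.

Lemma otype_seg_lt (w : wellorder) (x y : w) :
  wo_lt x y -> On_lt (otype (wo_seg x)) (otype (wo_seg y)).
Proof.
by move=> xy; apply/On_ltP; exists (exist _ x xy); rewrite wo_seg_seg.
Qed.

Lemma On_lt_wf : well_founded On_lt.
Proof.
have acc_seg (w : wellorder) (x : w) : Acc On_lt (otype (wo_seg x)).
  elim/(well_founded_ind (@wo_wf w)): x => x IH.
  by split=> b /On_ltP[y ->]; rewrite wo_seg_seg; apply: IH; case: y.
by move=> a; split=> b /asboolP[x ->].
Qed.

Lemma On_lt_irr : irreflexive On_lt.
Proof.
move=> a; apply/negbTE/negP.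
by elim/(well_founded_ind On_lt_wf): a => a IH aa; apply: (IH a).
Qed.

Lemma On_lt_trans : transitive On_lt.
Proof.
move=> b a c ab; rewrite -(otype_repr c); move: (repr c) => w /On_ltP[x bE].
move: ab; rewrite bE => /On_ltP[y ->]; rewrite wo_seg_seg.
by apply/On_ltP; exists (sval y).
Qed.

Lemma otype_seg_inj (w : wellorder) (x y : w) :
  otype (wo_seg x) = otype (wo_seg y) -> x = y.
Proof.
move=> E; case: (wo_total x y) => // /otype_seg_lt; by rewrite E On_lt_irr.
Qed.

Lemma otype_segE (w : wellorder) (x y : w) :
  wo_lt x y <-> On_lt (otype (wo_seg x)) (otype (wo_seg y)).
Proof.
split=> [|xy]; first exact: otype_seg_lt.
case: (wo_total x y) => // [E|/otype_seg_lt yx]; first by rewrite E On_lt_irr in xy.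
by have := On_lt_trans xy yx; rewrite On_lt_irr.
Qed.

Lemma On_ext a b : (forall c, On_lt c a <-> On_lt c b) -> a = b.
Proof.
rewrite -(otype_repr a) -(otype_repr b).
move: (repr a) (repr b) => v w H; apply/otype_eq.
have Hf (x : v) : exists y : w, otype (wo_seg x) = otype (wo_seg y).
  by apply/On_ltP/H/On_ltP; exists x.
have Hg (y : w) : exists x : v, otype (wo_seg y) = otype (wo_seg x).
  by apply/On_ltP/H/On_ltP; exists y.
have [f fP] := choice Hf; have [g gP] := choice Hg.
exists f.
  by exists g => [x|y]; apply: otype_seg_inj; [rewrite -gP -fP|rewrite -fP -gP].
by move=> x y; rewrite !otype_segE !fP.
Qed.

Lemma On_lt_total a b : a != b -> On_lt a b || On_lt b a.
Proof.
move=> ab; suff: [\/ On_lt a b, a = b | On_lt b a].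
  by case=> [->|/eqP|->]; rewrite ?orbT // (negbTE ab).
elim/(well_founded_ind On_lt_wf): a b {ab} => a IHa b.
elim/(well_founded_ind On_lt_wf): b => b IHb.
have [?|ab] := boolP (On_lt a b); first by constructor 1.
have [?|ba] := boolP (On_lt b a); first by constructor 3.
constructor 2; apply: On_ext => c; split=> [ca|cb].
  case: (IHa c ca b) => // [cb|bc]; first by rewrite -cb ca in ba.
  by rewrite (On_lt_trans bc ca) in ba.
case: (IHb c cb) => // [ac|ac]; last by rewrite ac cb in ab.
by rewrite (On_lt_trans ac cb) in ab.
Qed.

Fact On_display : Order.disp_t. Proof. exact: Order.Disp tt tt. Qed.

HB.instance Definition _ := @Order.LtOrder.Build On_display On
  (fun a b => (a == b) || On_lt a b) On_lt _ _
  (fun _ _ => erefl) (fun _ _ => erefl) (fun _ _ => erefl)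
  On_lt_irr On_lt_trans On_lt_total.

Fact void_wo_trans (x y z : void) : False -> False -> False. Proof. by []. Qed.
Fact void_wo_total (x y : void) : [\/ False, x = y | False]. Proof. by case: x. Qed.
Fact void_wo_wf : well_founded (fun x y : void => False). Proof. by case. Qed.

Definition On0 : On := otype (WellOrder void_wo_trans void_wo_total void_wo_wf).

Local Open Scope order_scope.

(* [below a] is the ordinal [a] viewed, in von Neumann's way, as the set of the
   smaller ordinals. *)
Definition below (a : On) : set On := [set x | x < a].

(* The value On0 on the empty set is never used below: succ_card, plus_card and
   cf take the least element of a nonempty set. *)
Definition least (P : set On) : On := xget On0 (P `&` lbound P).

Definition cardinal (k : On) : Prop := forall a, a < k -> below a #!= below k.

Definition succ_card (k : On) : On := least [set m | cardinal m /\ k < m].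

(* [plus_card k xi] is k^{+xi}: the least cardinal which is at least [k] and
   above every k^{+eta} with [eta < xi]; this merges the zero, successor and
   limit clauses of the recursion. *)
Definition plus_card (k : On) : On -> On :=
  Fix On_lt_wf (fun _ => On) (fun xi rec =>
    least [set m | [/\ cardinal m, k <= m &
                       forall eta (h : On_lt eta xi), rec eta h < m]]).

(* [<=] rather than [<], so that successor ordinals get cofinality 1. *)
Definition unbounded_in (b : On) (A : set On) : Prop :=
  A `<=` below b /\ forall g, g < b -> exists2 a, A a & g <= a.

Definition cf (b : On) : On :=
  least [set g | exists2 A, unbounded_in b A & A #= below g].

Definition regular_cardinal (k : On) : Prop :=
  [/\ cardinal k, infinite_set (below k) & cf k = k].

(* [below t -> below k] is the type of functions from t to k, so that its
   cardinality is k^t. *)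
Definition inaccessible_for (t l : On) : Prop :=
  forall k, cardinal k -> k < l ->
    let k_pow_t := [set: below t -> below k] in
    (k_pow_t #<= below l) /\ ~ (below l #<= k_pow_t).

Definition limit_of (C : set On) (d : On) : Prop :=
  On0 < d /\ forall g, g < d -> exists2 a, C a & g < a < d.

Definition club (l : On) (C : set On) : Prop :=
  unbounded_in l C /\ forall d, d < l -> limit_of C d -> C d.

Definition stationary (l : On) (S : set On) : Prop :=
  forall C, club l C -> S `&` C !=set0.

(* Only the values D i b with i < t and b < l are meaningful. *)
Definition covering_matrix (t l : On) (D : On -> On -> set On) : Prop :=
  [/\ forall b, b < l -> below b = \bigcup_(i in below t) D i b,
      forall b i j, b < l -> i < j -> j < t -> D i b `<=` D j b &
      forall b g i, b < g -> g < l -> i < t ->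
        exists2 j, j < t & D i b `<=` D j g].

Definition locally_downward_coherent (t l : On) (D : On -> On -> set On) : Prop :=
  forall X : set On, X `<=` below l -> X #<= below t ->
    exists2 gX, gX < l &
      forall b i, b < l -> i < t ->
        exists2 j, j < t & X `&` D i b `<=` X `&` D j gX.

Definition S_gt (l t : On) : set On := [set a | a < l /\ t < cf a].

Definition good_points (t l : On) (D : On -> On -> set On) : set On :=
  [set b | S_gt l t b /\
    exists2 A, unbounded_in b A &
      forall g, g < b -> exists a i, [/\ a < b, i < t & A `&` below g `<=` D i a]].

(* Main.v *)
(** Both hypotheses on [lambda] give the same strengthening of local downward
    coherence: every [c < lambda] has some [g < lambda] such that each trace
    [c ∩ D(i, b)] is contained in some [D(j, g)].

    If [lambda] is [theta]-inaccessible, let [g] bound the [gamma_X] of all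
    [X ⊆ c] of size at most [theta]: a trace contained in no [D(j, g)] would have
    a subset of size at most [theta] contained in no [D(j, g)].  If
    [lambda < theta^{+theta}], argue by induction on the cardinality of the set
    whose traces are considered.  A cardinal [k] strictly between [theta] and
    [theta^{+theta}] never has cofinality [theta], so when a set of size [k] is
    written as an increasing union of [k] smaller sets, the indices [j] obtained
    for cofinally many of the pieces have a common bound below [theta].

    Now let [b] be closed under [c |-> g] with [cf b > theta].  Some [D(i, b)] is
    unbounded in [b], and its traces on the [c < b] show that [b] is good. *)

Require Import Defs.
From HB Require Import structures.
From Stdlib Require Import Relations Wellfounded.
From mathcomp Require Import all_boot all_order all_classical.

Local Open Scope classical_set_scope.
Local Open Scope order_scope.

Import Order.TTheory.

Set Implicit Arguments.
Unset Strict Implicit.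
Unset Printing Implicit Defensive.

Local Open Scope card_scope.

HB.instance Definition _ := isPointed.Build On On0.

(** * Sets and cardinality *)

Lemma exists2_choice T (U : pointedType) (A : set T) (P Q : T -> U -> Prop) :
  (forall x, A x -> exists2 y, P x y & Q x y) ->
  exists2 f : T -> U, forall x, A x -> P x (f x) & forall x, A x -> Q x (f x).
Proof.
move=> PQ; have /choice[f fP] x : exists y, A x -> P x y /\ Q x y.
  have [/PQ[y Py Qy]|nAx] := pselect (A x); first by exists y.
  by exists point.
by exists f => x /fP[].
Qed.

Lemma card_le_injP T (U : pointedType) (A : set T) (B : set U) :
  reflect (exists2 f : T -> U, set_fun A B f & set_inj A f) (A #<= B).
Proof. by apply: (iffP pcard_leP) => /injfunPex. Qed.

Lemma infinite_card_setU1 T (x : T) (A : set T) :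
  infinite_set A -> x |` A #<= A.
Proof.
elim/Ppointed: T => T in A x *; first by case: (no x).
move=> /infiniteP/card_le_injP[e eA /(@pinvKV _ _ _ _) eK].
pose shift y := if y \in range e then if pinv setT e y is n.+1 then e n else x else y.
have shift_e n : shift (e n) = if n is m.+1 then e m else x.
  by rewrite /shift eK ?inE // ifT // inE; exists n.
apply: card_le_trans (card_image_le shift A).
apply: subset_card_le => y [->|Ay].
  by exists (e 0%N); [exact: eA|rewrite shift_e].
have [[n _ <-]|ye] := pselect (range e y).
  by exists (e n.+1); [exact: eA|rewrite shift_e].
by exists y => //; rewrite /shift memNset.
Qed.

Lemma card_le_setX T T' (U U' : pointedType)
    (A : set T) (A' : set T') (B : set U) (B' : set U') :
  A #<= B -> A' #<= B' -> A `*` A' #<= B `*` B'.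
Proof.
move=> /card_le_injP[f fB fI] /card_le_injP[g gB gI].
apply/card_le_injP; exists (fun p => (f p.1, g p.2)).
  by move=> [x y] [/= Ax Ay]; split; [apply: fB|apply: gB].
move=> [x y] [x' y']; rewrite !inE /= => -[Ax Ay] [Ax' Ay'] [fxx' gyy'].
by congr pair; [apply: fI|apply: gI] => //; rewrite inE.
Qed.

Lemma card_bigcup_le (T V : pointedType) U (I : set T) (E : T -> set U) (B : set V) :
  (forall i, I i -> E i #<= B) -> \bigcup_(i in I) E i #<= I `*` B.
Proof.
move=> EB.
have [e eEB eI] := exists2_choice (fun i Ii => card_le_injP _ _ (EB i Ii)).
have [i iI iE] := @exists2_choice _ _ (\bigcup_(i in I) E i)
  (fun _ i => I i) (fun x i => E i x) (fun _ => id).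
apply/card_le_injP; exists (fun x => (i x, e (i x) x)).
  by move=> x Ux; split; [exact: iI|exact: eEB (iI _ Ux) _ (iE _ Ux)].
move=> x y; rewrite !inE => Ux Uy [ixy]; rewrite ixy.
by apply: eI; rewrite ?inE; [exact: iI|rewrite -ixy|]; exact: iE.
Qed.

Lemma card_images_le T U V (I : set T) (A : set U) (B : set V) :
  A #= B -> [set h @` I | h in set_fun I A] #<= [set: I -> B].
Proof.
move=> /card_bijP[e [e' ee' _]].
pose im (u : I -> B) : set U := range (fun i => set_val (e' (u i))).
apply: card_le_trans (card_image_le im _); apply: subset_card_le => _ [h hA <-].
exists (fun i => e (SigSub (mem_set (hA _ (set_valP i))))) => //.
apply/seteqP; split=> [_ [i _ <-]|_ [i Ii <-]].
  by rewrite ee'; exists (set_val i) => //; exact: set_valP.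
by exists (SigSub (mem_set (Ii : I i))); rewrite ?ee'.
Qed.

(** * Well-orders and their order types *)

Lemma prodlexi_lt_wf d d' (A : orderType d) (B : orderType d') :
  well_founded (fun x y : A => x < y) -> well_founded (fun x y : B => x < y) ->
  well_founded (fun x y : (A *l B)%type => x < y).
Proof.
move=> Awf Bwf; apply: (wf_incl _ _ _ _ (wf_slexprod _ _ _ _ Awf Bwf)).
move=> [x y] [x' y']; rewrite Order.ProdLexiOrder.ltEprodlexi /=.
by case: (ltgtP x x') => //= [xx' _|-> yy']; [exact: left_slex|exact: right_slex].
Qed.

Section Pullback.
Variables (d : Order.disp_t) (O : orderType d) (T : Type) (f : T -> O).
Hypotheses (O_wf : well_founded (fun x y : O => x < y)) (f_inj : injective f).

Fact wo_pullback_trans x y z : f x < f y -> f y < f z -> f x < f z.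
Proof. exact: lt_trans. Qed.

Fact wo_pullback_total x y : [\/ f x < f y, x = y | f y < f x].
Proof.
have [?|?|/f_inj ?] := ltgtP (f x) (f y).
- by constructor 1.
- by constructor 3.
- by constructor 2.
Qed.

Definition wo_pullback : wellorder :=
  WellOrder wo_pullback_trans wo_pullback_total (wf_inverse_image _ _ _ f O_wf).
End Pullback.

Lemma On_ind (P : On -> Prop) :
  (forall a, (forall b, b < a -> P b) -> P a) -> forall a, P a.
Proof. exact: (well_founded_ind On_lt_wf). Qed.

Lemma below_subset a b : a <= b -> below a `<=` below b.
Proof. by move=> ab x /= xa; apply: lt_le_trans ab. Qed.

Lemma card_le_below a b : a <= b -> below a #<= below b.
Proof. by move=> /below_subset/subset_card_le. Qed.

Lemma infinite_below_le a b :
  a <= b -> infinite_set (below a) -> infinite_set (below b).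
Proof. by move=> /below_subset; exact: sub_infinite_set. Qed.

Lemma below_otype (w : wellorder) :
  below (otype w) = range (fun x : w => otype (wo_seg x)).
Proof.
apply/seteqP; split=> [a /On_ltP[x ->]|_ [x _ <-]]; first by exists x.
by apply/On_ltP; exists x.
Qed.

Lemma card_below_otype (w : wellorder) : below (otype w) #= [set: w].
Proof.
by rewrite below_otype; apply: inj_card_eq => x y _ _; exact: otype_seg_inj.
Qed.

Lemma card_eq_below b (A : set On) : A `<=` below b -> exists a, A #= below a.
Proof.
rewrite -(otype_repr b) below_otype => Ab.
pose rank (x : {x : repr b | A (otype (wo_seg x))}) := otype (wo_seg (sval x)).
have rank_inj : injective rank by move=> x y /otype_seg_inj/sval_inj.
have AE : A = range rank.
  apply/seteqP; split=> [a Aa|_ [[x Ax] _ <-]//].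
  by have [x _ xa] := Ab a Aa; rewrite -xa in Aa *; exists (exist _ x Aa).
exists (otype (wo_pullback On_lt_wf rank_inj)).
apply: card_eq_trans (card_esym (card_below_otype _)).
by rewrite [X in X #= _]AE; apply: inj_card_eq => x y _ _; exact: rank_inj.
Qed.

(** * Least elements, cardinals and cofinality *)

Lemma leastP (P : set On) : P !=set0 -> P (least P) /\ lbound P (least P).
Proof.
move=> [x Px]; apply: (@xgetPex _ _ (P `&` lbound P)).
apply: contrapT => nP; move: x Px; elim/On_ind => a IH Pa; apply: nP.
by exists a; split=> // y Py; rewrite leNgt; apply/negP => /IH; exact.
Qed.

Lemma least_in (P : set On) a : P a -> P (least P).
Proof. by move=> Pa; have [] := @leastP P (ex_intro _ a Pa). Qed.

Lemma least_le (P : set On) a : P a -> least P <= a.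
Proof. by move=> Pa; have [_ /(_ a Pa)] := @leastP P (ex_intro _ a Pa). Qed.

Lemma lt_least (P : set On) a : a < least P -> ~ P a.
Proof. by move=> + /least_le; rewrite ltNge => /negP. Qed.

Lemma lt_cardinal_ncard_le k a : cardinal k -> a < k -> ~ (below k #<= below a).
Proof.
move=> kC ak ka; have /negP := kC _ ak; apply; apply/card_eqPle; split=> //.
exact/card_le_below/ltW.
Qed.

Lemma exists_cardinal_eq a :
  exists k, [/\ cardinal k, k <= a & below k #= below a].
Proof.
pose P := [set k | below k #= below a].
have Pa : P a by exact: card_eqxx.
exists (least P); split; [|exact: least_le|exact: (least_in Pa)].
move=> b /lt_least nPb; apply/negP => bP; apply: nPb.
exact: card_eq_trans bP (least_in Pa).
Qed.

Lemma infinite_cardinal_limit k a : cardinal k -> infinite_set (below k) ->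
  a < k -> exists2 b, a < b & b < k.
Proof.
move=> kC kinf ak; apply: contrapT => nb.
have kE : below k = a |` below a.
  apply/seteqP; split=> [x xk|x [->//|xa]]; last exact: lt_trans xa ak.
  have [xa|ax|->] := ltgtP x a; [by right| |by left].
  by case: nb; exists x.
apply: (lt_cardinal_ncard_le kC ak); rewrite kE; apply: infinite_card_setU1 => afin.
by apply: kinf; rewrite kE finite_setU; split=> //; exact: finite_set1.
Qed.

Lemma unbounded_in_below b : unbounded_in b (below b).
Proof. by split=> // g gb; exists g. Qed.

Lemma cf_unbounded_in b : exists2 A, unbounded_in b A & A #= below (cf b).
Proof.
apply: (@least_in [set g | exists2 A, unbounded_in b A & A #= below g] b).
by exists (below b); [exact: unbounded_in_below|exact: card_eqxx].
Qed.

Lemma cf_le b : cf b <= b.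
Proof.
by apply: least_le; exists (below b); [exact: unbounded_in_below|exact: card_eqxx].
Qed.

Lemma cardinal_cf b : cardinal (cf b).
Proof.
move=> a /lt_least acf; apply/negP => acard; apply: acf.
have [A Aub Acard] := cf_unbounded_in b; exists A => //.
exact: card_eq_trans (card_esym acard).
Qed.

Lemma unbounded_in_card_ge b (A : set On) : unbounded_in b A -> below (cf b) #<= A.
Proof.
move=> Aub; have [a Aa] := card_eq_below Aub.1; rewrite (card_le_eqr Aa).
by apply/card_le_below/least_le; exists A.
Qed.

Lemma unbounded_in_or_bounded b (A : set On) : A `<=` below b ->
  unbounded_in b A \/ exists2 s, s < b & unbounded_in s A.
Proof.
pose P := [set s | A `<=` below s] => Ab.
have sA : unbounded_in (least P) A.
  split=> [|g /lt_least nPg]; first exact: (@least_in P b).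
  apply: contrapT => nA; apply: nPg => a Aa.
  by rewrite /below /= ltNge; apply/negP => ga; apply: nA; exists a.
have : least P <= b by exact: least_le.
by rewrite le_eqVlt => /predU1P[<-|]; [left|right; exists (least P)].
Qed.

Lemma card_lt_cf_bounded b (A : set On) : A `<=` below b ->
  ~ (below (cf b) #<= A) -> exists2 s, s < b & unbounded_in s A.
Proof. by move=> /unbounded_in_or_bounded[/unbounded_in_card_ge|]. Qed.

Lemma lt_cf_bounded b a (f : On -> On) : a < cf b ->
  (forall x, x < a -> f x < b) -> exists2 s, s < b & forall x, x < a -> f x < s.
Proof.
move=> acf fb.
have [_ [x xa <-]||s sb [fs _]] := @card_lt_cf_bounded b (f @` below a).
- exact: fb.
- move=> /card_le_trans/(_ (card_image_le _ _)).
  exact: lt_cardinal_ncard_le (@cardinal_cf b) acf.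
- by exists s => // x xa; apply: fs; exists x.
Qed.

Lemma lt_cf_bigcup_unbounded b a (E : On -> set On) : a < cf b ->
  below b = \bigcup_(i in below a) E i -> exists2 i, i < a & unbounded_in b (E i).
Proof.
move=> acf bE; apply: contrapT => nub.
have /exists2_choice[s sb sE] i : below a i -> exists2 s, s < b & E i `<=` below s.
  move=> ia; have [|Eub|[s sb [Es _]]] := @unbounded_in_or_bounded b (E i).
  - by rewrite bE => x Ex; exists i.
  - by case: nub; exists i.
  - by exists s.
have [g gb sg] := lt_cf_bounded acf sb.
have [i ia gE] : (\bigcup_(i in below a) E i) g by rewrite -bE.
by have := lt_trans (sg i ia) (sE i ia _ gE); rewrite ltxx.
Qed.

Lemma cf_neq_unbounded_fibers c t (f : On -> On) : cf t = t -> cf c <> t ->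
  (forall a, a < c -> f a < t) ->
  exists2 j, j < t & unbounded_in c [set a | a < c /\ f a <= j].
Proof.
move=> tcf /eqP; rewrite neq_lt => /orP[ct|tc] fc.
  have [A [Ac Aub] Acard] := cf_unbounded_in c.
  have [_ [a /Ac/fc fat <-//]||j jt [fj _]] := @card_lt_cf_bounded t (f @` A).
    rewrite tcf => /card_le_trans/(_ (card_image_le _ _)); rewrite (card_le_eqr Acard).
    by apply: lt_cardinal_ncard_le ct; rewrite -tcf; exact: cardinal_cf.
  exists j => //; split=> [a []//|g /Aub[a Aa ga]]; exists a => //.
  by split; [exact: Ac|apply/ltW/fj; exists a].
apply: lt_cf_bigcup_unbounded => //; apply/seteqP; split=> [a ac|a [j _ []//]].
by exists (f a); [exact: fc|split].
Qed.

(** * Squares of infinite ordinals *)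

Definition godel_key (p : On * On) : On *l (On *l On) := (Order.max p.1 p.2, p).

Definition seg_otypes (w : wellorder) (p : w * w) : On * On :=
  (otype (wo_seg p.1), otype (wo_seg p.2)).

Lemma seg_otypes_inj (w : wellorder) : injective (@seg_otypes w).
Proof. by move=> [x y] [x' y'] [/otype_seg_inj-> /otype_seg_inj->]. Qed.

Lemma godel_key_seg_otypes_inj (w : wellorder) :
  injective (godel_key \o @seg_otypes w).
Proof. by move=> p q /(congr1 snd)/seg_otypes_inj. Qed.

Definition godel_square (w : wellorder) : wellorder :=
  wo_pullback (prodlexi_lt_wf On_lt_wf (prodlexi_lt_wf On_lt_wf On_lt_wf))
    (@godel_key_seg_otypes_inj w).

Lemma card_godel_square (w : wellorder) :
  below (otype w) `*` below (otype w) #<= below (otype (godel_square w)).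
Proof.
rewrite (card_le_eqr (card_below_otype _)).
apply: card_le_trans (card_image_le (@seg_otypes w) setT); rewrite below_otype.
by apply: subset_card_le => -[_ _] [/= [x _ <-] [y _ <-]]; exists (x, y).
Qed.

Lemma card_godel_square_seg (w : wellorder) (p : godel_square w) b :
  Order.max (seg_otypes p).1 (seg_otypes p).2 < b ->
  below (otype (wo_seg p)) #<= below b `*` below b.
Proof.
move=> pb; rewrite (card_le_eql (card_below_otype _)).
apply/card_le_injP; exists (@seg_otypes w \o sval) => [[q /= qp] _|q q' _ _].
  move: qp; rewrite /= Order.ProdLexiOrder.ltEprodlexi => /andP[/le_lt_trans/(_ pb)+ _].
  by rewrite gt_max => /andP[].
by move=> /seg_otypes_inj/sval_inj.
Qed.

(* If the Goedel well-order of [k * k] were longer than [k], then [k] would be the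
   type of one of its proper initial segments, hence embed in [b * b] with [b < k]. *)
Lemma card_setX_cardinal k : cardinal k -> infinite_set (below k) ->
  (forall b, b < k -> infinite_set (below b) -> below b `*` below b #<= below b) ->
  below k `*` below k #<= below k.
Proof.
move=> kC kinf IH; rewrite -{1 2}(otype_repr k).
apply: card_le_trans (card_godel_square _) _.
apply: card_le_below; rewrite leNgt; apply/negP => /On_ltP[p kp].
have max_lt : Order.max (seg_otypes p).1 (seg_otypes p).2 < k.
  by rewrite -[ltRHS]otype_repr gt_max; apply/andP; split; apply/On_ltP; eexists.
have [b pb bk] := infinite_cardinal_limit kC kinf max_lt.
have := card_godel_square_seg pb; rewrite -kp => kbb.
have [bfin|binf] := pselect (finite_set (below b)).
  by apply: kinf; apply: card_le_finite kbb _; exact: finite_setX.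
exact: (lt_cardinal_ncard_le kC bk) (card_le_trans kbb (IH b bk binf)).
Qed.

Lemma infinite_card_setX a : infinite_set (below a) ->
  below a `*` below a #<= below a.
Proof.
elim/On_ind: a => a IH ainf; have [k [kC ka kcard]] := exists_cardinal_eq a.
have /andP[kcard_le kcard_ge] : (below k #<= below a) && (below a #<= below k).
  by apply/andP/card_eqPle.
apply: card_le_trans kcard_le; apply: card_le_trans (card_le_setX kcard_ge kcard_ge) _.
have kinf : infinite_set (below k) by move=> /(card_le_finite kcard_ge).
move: ka; rewrite le_eqVlt => /predU1P[ka|/IH/(_ kinf)//].
by apply: card_setX_cardinal => // b bk; apply: IH; rewrite -ka.
Qed.

(** * Cofinality of the cardinals between [t] and [t^{+t}] *)

Lemma plus_cardE k xi : plus_card k xi =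
  least [set m | [/\ cardinal m, k <= m & forall eta, eta < xi -> plus_card k eta < m]].
Proof.
rewrite {1}/plus_card Fix_eq // => {}xi f g fg; congr (least _).
apply/funext => o; apply/propext; split=> -[oC ko H]; split=> // eta h.
  by rewrite -fg; apply: H.
by rewrite fg; apply: H.
Qed.

Lemma lt_succ_card_card_le k a : a < succ_card k -> below a #<= below k.
Proof.
have [m [mC ma mcard]] := exists_cardinal_eq a.
move=> /(le_lt_trans ma)/lt_least nm; rewrite -(card_le_eql mcard).
apply: card_le_below; rewrite leNgt; apply/negP => km.
exact: nm.
Qed.

(* The first two hypotheses rule out the junk value of [least]. *)
Lemma cf_succ_card k : cardinal (succ_card k) -> k < succ_card k ->
  infinite_set (below k) -> cf (succ_card k) = succ_card k.
Proof.
set c := succ_card k => cC kc kinf; apply/eqP; rewrite eq_le cf_le leNgt.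
apply/negP => cfc; have [A [Ac Aub] Acard] := cf_unbounded_in c.
have cinf : infinite_set (below c) by apply: infinite_below_le kinf; exact: ltW.
apply: (lt_cardinal_ncard_le cC kc); apply: card_le_trans (infinite_card_setX kinf).
have Ak : A #<= below k by rewrite (card_le_eql Acard); exact: lt_succ_card_card_le.
apply: card_le_trans (card_le_setX Ak (card_lexx (below k))).
apply: (@card_le_trans _ _ _ (\bigcup_(a in A) below a)).
  apply: subset_card_le => x /(infinite_cardinal_limit cC cinf)[y xy /Aub[a Aa ya]].
  by exists a => //; exact: lt_le_trans ya.
by apply: card_bigcup_le => a /Ac; exact: lt_succ_card_card_le.
Qed.

Lemma plus_card_succ_card t xi g : cardinal (plus_card t xi) ->
  t < plus_card t xi -> g < plus_card t xi ->
  (forall eta, eta < xi -> plus_card t eta <= g) ->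
  plus_card t xi = succ_card (Order.max g t).
Proof.
set c := plus_card t xi => cC tc gc plus_g.
pose P := [set m | cardinal m /\ Order.max g t < m].
have Pc : P c by rewrite /P /= gt_max gc.
have [sC] : P (succ_card (Order.max g t)) by exact: least_in Pc.
rewrite gt_max => /andP[gs ts]; apply/eqP; rewrite eq_le; apply/andP; split.
  rewrite /c plus_cardE; apply: least_le; split=> // [|eta /plus_g]; first exact: ltW.
  by move=> /le_lt_trans; apply.
exact: least_le.
Qed.

Lemma lt_plus_card_cf_neq t c : infinite_set (below t) -> cardinal c ->
  t < c -> c < plus_card t t -> cf c <> t.
Proof.
move=> tinf cC tc ct; pose P := [set xi | c <= plus_card t xi].
have Pt : P t by exact: ltW.
have plus_lt eta : eta < least P -> plus_card t eta < c.
  by move=> /lt_least nP; rewrite ltNge; apply/negP.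
have cE : c = plus_card t (least P).
  apply/eqP; rewrite eq_le; apply/andP; split; first exact: (least_in Pt).
  by rewrite plus_cardE; apply: least_le; split=> //; exact: ltW.
have [_ [eta /plus_lt ? <-]//|cub|[g gc [plus_g _]]] :=
    @unbounded_in_or_bounded c (plus_card t @` below (least P)).
  have : least P < t.
    rewrite lt_neqAle (least_le Pt) andbT; apply/eqP => PE.
    by move: ct; rewrite cE PE ltxx.
  move=> + cft; rewrite -cft => /(lt_cardinal_ncard_le (@cardinal_cf c)); apply.
  exact: card_le_trans (unbounded_in_card_ge cub) (card_image_le _ _).
have succE : c = succ_card (Order.max g t).
  rewrite cE; apply: plus_card_succ_card; rewrite -?cE // => eta etaP.
  by apply/ltW/plus_g; exists eta.
have hinf : infinite_set (below (Order.max g t)).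
  by apply: infinite_below_le tinf; rewrite le_max lexx orbT.
rewrite succE cf_succ_card -?succE // ?gt_max ?gc // => ctE.
by move: tc; rewrite ctE ltxx.
Qed.

(** * Clubs *)

Lemma club_below l : club l (below l).
Proof. by split=> //; exact: unbounded_in_below. Qed.

Definition closure_points (l : On) (F : On -> On) : set On :=
  [set b | b < l /\ forall c, c < b -> F c < b].

Lemma club_closure_points l (F : On -> On) :
  regular_cardinal l -> ~ countable (below l) -> (forall c, c < l -> F c < l) ->
  club l (closure_points l F).
Proof.
move=> [lC linf lcf] lunc Fl; split; last first.
  move=> d dl [_ dlim]; split=> // c cd; have [a [_ Fa] /andP[ca ad]] := dlim c cd.
  exact: lt_trans (Fa c ca) ad.
split=> [b []//|g gl].
have /exists2_choice[next next_lt nextP] b : below l b ->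
    exists2 b', b' < l & b < b' /\ forall c, c < b -> F c < b'.
  move=> bl; have [||b1 b1l Fb1] := @lt_cf_bounded l b F; first by rewrite lcf.
    by move=> c cb; apply: Fl; exact: lt_trans bl.
  have [b2 bb2 b2l] := infinite_cardinal_limit lC linf bl.
  exists (Order.max b1 b2); first by rewrite gt_max b1l.
  by split=> [|c /Fb1 Fc]; rewrite lt_max ?bb2 ?orbT // Fc.
pose b n := iter n next g.
have bl n : b n < l by elim: n => //= n /next_lt.
have [_ [n _ <-]||s sl [bs bcof]] := @card_lt_cf_bounded l (range b).
- exact: bl.
- by rewrite lcf => /card_le_trans/(_ (card_image_le _ _)).
exists s; last by apply/ltW/bs; exists 0%N.
split=> // c /bcof[_ [n _ <-] cbn].
have [bSn _] := nextP _ (bl n); have [_ Fb] := nextP _ (bl n.+1).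
by apply: lt_trans (Fb c (le_lt_trans cbn bSn)) (bs _ _); exists n.+2.
Qed.

(** * Traces of the covering matrix *)

(* [X] may be larger than [t], unlike in [locally_downward_coherent]. *)
Definition captured (t l : On) (D : On -> On -> set On) (X : set On) (g : On) : Prop :=
  forall b i, b < l -> i < t -> exists2 j, j < t & X `&` D i b `<=` D j g.

Section Captured.
Variables (t l : On) (D : On -> On -> set On).

Lemma captured_images X g :
  (forall h : On -> On, set_fun (below t) X h -> captured t l D (h @` below t) g) ->
  captured t l D X g.
Proof.
move=> Xg b i bl it; apply: contrapT => nj.
have /exists2_choice[h hXD nhD] j :
    below t j -> exists2 x, (X `&` D i b) x & ~ D j g x.
  move=> jt; apply: contrapT => nx; apply: nj; exists j => // x XDx.
  by apply: contrapT => nDx; apply: nx; exists x.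
have [j jt|j jt hD] := Xg h _ b i bl it; first by have [] := hXD j jt.
by apply: (nhD j jt); apply: hD; split; [exists j|have [] := hXD j jt].
Qed.

Hypothesis D_cover : covering_matrix t l D.

Lemma captured_lt X g h : g < h -> h < l -> captured t l D X g -> captured t l D X h.
Proof.
move=> gh hl Xg b i bl it; have [j jt XD] := Xg b i bl it.
have [_ _ /(_ g h j gh hl jt)[j' j't Djj']] := D_cover.
by exists j' => // x /XD/Djj'.
Qed.

(* If [captured t l D (Y a) g] provides the index [J a], then the [a] with
   [J a <= j] are cofinal in [c] for some [j < t], because [cf c <> t]. *)
Lemma captured_chain c (Y : On -> set On) g : cf t = t -> cf c <> t -> g < l ->
  {homo Y : a a' / a <= a' >-> a `<=` a'} ->
  (forall a, a < c -> captured t l D (Y a) g) ->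
  captured t l D (\bigcup_(a in below c) Y a) g.
Proof.
move=> tcf cfc gl Ymono Yg b i bl it.
have /exists2_choice[J Jt YJ] a :
    below c a -> exists2 j, j < t & Y a `&` D i b `<=` D j g by move=> /Yg; apply.
have [j jt [_ jcof]] := cf_neq_unbounded_fibers tcf cfc Jt.
exists j => // x [[a /jcof[a' [a'c Jj] aa'] Yx] Dx].
have [_ Dmono _] := D_cover.
have : D (J a') g x by apply: YJ => //; split=> //; exact: Ymono aa' _ Yx.
by move: Jj; rewrite le_eqVlt => /predU1P[->//|Jj]; exact: Dmono.
Qed.

Section Coherent.
Hypothesis l_regular : regular_cardinal l.
Hypothesis D_coherent : locally_downward_coherent t l D.

Lemma small_captured X : X `<=` below l -> X #<= below t ->
  exists2 g, g < l & captured t l D X g.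
Proof.
move=> Xl Xt; have [g gl XD] := D_coherent Xl Xt; exists g => // b i bl it.
by have [j jt XDj] := XD b i bl it; exists j => // x /XDj[].
Qed.

Lemma inaccessible_captured c : inaccessible_for t l -> c < l ->
  exists2 g, g < l & captured t l D (below c) g.
Proof.
move=> inacc cl; have [k [kC kc kcard]] := exists_cardinal_eq c.
have [_ nlk] := inacc k kC (le_lt_trans kc cl); have [_ _ lcf] := l_regular.
pose images := [set h @` below t | h in set_fun (below t) (below c)].
have /exists2_choice[G Gl YG] Y : images Y -> exists2 g, g < l & captured t l D Y g.
  move=> [h hc <-]; apply: small_captured; last exact: card_image_le.
  by move=> _ [j jt <-]; exact: lt_trans (hc j jt) cl.
have [_ [Y /Gl ? <-]//||s sl [Gs _]] := @card_lt_cf_bounded l (G @` images).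
  rewrite lcf => lG; apply: nlk; apply: card_le_trans lG _.
  exact: card_le_trans (card_image_le _ _) (card_images_le _ (card_esym kcard)).
exists s => //; apply: captured_images => h hc.
have Yh : images (h @` below t) by exists h.
by apply: captured_lt (YG _ Yh) => //; apply: Gs; exists (h @` below t).
Qed.

Lemma lt_plus_card_captured c X : regular_cardinal t -> l < plus_card t t ->
  c < l -> X `<=` below l -> X #<= below c ->
  exists2 g, g < l & captured t l D X g.
Proof.
move=> [_ tinf tcf] lt; have [_ _ lcf] := l_regular.
elim/On_ind: c X => c IH X cl Xl Xc.
have [ct|tc] := leP c t.
  by apply: small_captured => //; apply: card_le_trans Xc _; exact: card_le_below.
have [k [kC + kcard]] := exists_cardinal_eq c.
rewrite le_eqVlt => /predU1P[kE|kc]; last first.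
  by apply: (IH k kc) => //; [exact: lt_trans cl|rewrite (card_le_eqr kcard)].
have cC : cardinal c by rewrite -kE.
have cinf : infinite_set (below c) by apply: infinite_below_le tinf; exact: ltW.
have [f fc finj] := card_le_injP _ _ Xc.
pose Y a := X `&` [set x | f x < a].
have /exists2_choice[G Gl YG] a : below c a -> exists2 g, g < l & captured t l D (Y a) g.
  move=> ac; apply: (IH a ac); [exact: lt_trans cl|by move=> x [/Xl]|].
  apply/card_le_injP; exists f => [x []//|x y].
  by rewrite !inE => -[Xx _] [Xy _]; apply: finj; rewrite inE.
have [||g gl Gg] := @lt_cf_bounded l c G; [by rewrite lcf|exact: Gl|].
have XE : X = \bigcup_(a in below c) Y a.
  apply/seteqP; split=> [x Xx|x [a _ []//]].
  by have [a fa ac] := infinite_cardinal_limit cC cinf (fc x Xx); exists a.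
exists g => //; rewrite XE; apply: captured_chain => //.
- exact: lt_plus_card_cf_neq tinf cC tc (lt_trans cl lt).
- by move=> a a' aa' x [Xx fxa]; split=> //; exact: lt_le_trans aa'.
- by move=> a ac; apply: captured_lt (YG a ac) => //; exact: Gg.
Qed.

End Coherent.

Lemma closure_point_good (F : On -> On) b :
  (forall c, c < l -> captured t l D (below c) (F c)) ->
  closure_points l F b -> t < cf b -> good_points t l D b.
Proof.
move=> FD [bl Fb] tb; have [Dcover _ _] := D_cover.
have [i it Dub] := lt_cf_bigcup_unbounded tb (Dcover b bl).
split=> //; exists (D i b) => // c cb.
have [j jt Dj] := FD c (lt_trans cb bl) b i bl it.
by exists (F c), j; split=> //; [exact: Fb|rewrite setIC].
Qed.

Lemma captured_nonstationary :
  infinite_set (below t) -> regular_cardinal l ->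
  (forall c, c < l -> exists2 g, g < l & captured t l D (below c) g) ->
  ~ stationary l (S_gt l t `\` good_points t l D).
Proof.
move=> tinf lR /(exists2_choice (A := below l))[F Fl FD] stat.
have [b [[[bl tb] _] _]] := stat _ (club_below l).
have lunc : ~ countable (below l).
  have tl : t < l := lt_le_trans tb (le_trans (cf_le b) (ltW bl)).
  move=> lcount; have [lC _ _] := lR; apply: (lt_cardinal_ncard_le lC tl).
  by apply: card_le_trans lcount _; apply/infiniteP.
have [b' [[[b'l tb'] nb'] b'F]] := stat _ (club_closure_points lR lunc Fl).
exact/nb'/(closure_point_good FD).
Qed.

End Captured.

Theorem theorem6p18 (theta lambda : On) (D : On -> On -> set On) :
  regular_cardinal theta ->
  regular_cardinal lambda ->
  (succ_card theta < lambda /\ lambda < plus_card theta theta) \/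
    inaccessible_for theta lambda ->
  covering_matrix theta lambda D ->
  locally_downward_coherent theta lambda D ->
  ~ stationary lambda (S_gt lambda theta `\` good_points theta lambda D).
Proof.
move=> thetaR lambdaR hyp Dcover Dcoherent; have [_ theta_inf _] := thetaR.
apply: captured_nonstationary => // c cl.
case: hyp => [[_ lt_plus]|inacc]; last exact: inaccessible_captured.
apply: (lt_plus_card_captured Dcover lambdaR Dcoherent thetaR lt_plus cl).
- exact/below_subset/ltW.
- exact: card_lexx.
Qed.
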